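(* If $A_{\mathrm{ext}}$ generates a contractive $C_0$-semigroup on $H_1 \times H_2$, then $$\sigma(A_S) \cap \mathrm{i}\mathbb{R} \subseteq \sigma(A_{\mathrm{ext}}) \cap \mathrm{i}\mathbb{R},$$ where $\sigma(\cdot)$ denotes the spectrum.
   Context: Inner products on complex Hilbert spaces are linear in the first and antilinear in the second component. Let $H_1, H_2$ be non-zero complex Hilbert spaces, let $A_1: \operatorname{dom}(A_1) \subseteq H_1 \times H_2 \to H_1$ and $A_{21}: \operatorname{dom}(A_{21}) \subseteq H_1 \to H_2$ be linear operators (defined on vector subspaces), and let $S: H_2 \to H_2$ be a bounded linear operator that is coercive: there is $\nu > 0$ with $\operatorname{Re}(h_2 | S h_2)_{H_2} \ge \nu \|h_2\|_{H_2}^2$ for all $h_2 \in H_2$. The operator $A_{\mathrm{ext}}$ on $H_1 \times H_2$ has domain $\operatorname{dom}(A_{\mathrm{ext}}) = \{ (h_1,h_2) \in \operatorname{dom}(A_1) : h_1 \in \operatorname{dom}(A_{21}) \}$ and acts as $A_{\mathrm{ext}}(h_1,h_2) = (A_1(h_1,h_2),\, A_{21}h_1)$. The operator $A_S$ on $H_1$ has domain $\operatorname{dom}(A_S) = \{ h_1 \in \operatorname{dom}(A_{21}) : (h_1, S A_{21} h_1) \in \operatorname{dom}(A_1) \}$ and acts as $A_S h_1 = A_1 (h_1, S A_{21} h_1)$. (Known theorem of Zwart, Le Gorrec and Maschke: if $A_{\mathrm{ext}}$ generates a contractive $C_0$-semigroup on $H_1\times H_2$, then $A_S$ generates a contractive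 $C_0$-semigroup on $H_1$.) *)

(* Defs.v *)
From HB Require Import structures.
From mathcomp Require Import all_boot all_order all_algebra.
From mathcomp Require Import complex ring.
From mathcomp Require Import boolp classical_sets functions filter reals topology.
From mathcomp Require Import normedtype.

Set Implicit Arguments.
Unset Strict Implicit.
Unset Printing Implicit Defensive.

Import Order.TTheory GRing.Theory Num.Theory numFieldNormedType.Exports.

Local Open Scope classical_set_scope.
Local Open Scope ring_scope.

HB.mixin Record CompleteNormedModule_isHilbert (R : realType) H
    of CompleteNormedModule R[i] H := {
  inner : H -> H -> R[i] ;
  inner_linearl : forall y, linear_for *%R (inner^~ y) ;
  innerC : forall x y, inner x y = Num.conj (inner y x) ;
  inner_norm : forall x, inner x x = `|x| ^+ 2
}.

#[short(type="hilbertType")]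
HB.structure Definition Hilbert (R : realType) :=
  {H of CompleteNormedModule R[i] H & CompleteNormedModule_isHilbert R H}.

(* The library equips [H1 * H2] with the maximum norm, which does not come from
   an inner product; [hprod] carries the norm of the Hilbert space product. *)
Definition hprod (H1 H2 : Type) : Type := (H1 * H2)%type.

Section HilbertProduct.
Variables (R : realType) (H1 H2 : hilbertType R).
Local Notation H := (hprod H1 H2).

HB.instance Definition _ := GRing.Lmodule.copy H (H1 * H2)%type.

Definition hprod_norm (x : H) : R[i] := sqrtC (`|x.1| ^+ 2 + `|x.2| ^+ 2).

Let hprod_norm_ge0 x : 0 <= hprod_norm x.
Proof. by rewrite sqrtC_ge0 addr_ge0 ?exprn_ge0. Qed.

Let hprod_norm_sqr x : hprod_norm x ^+ 2 = `|x.1| ^+ 2 + `|x.2| ^+ 2.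
Proof. exact: sqrtCK. Qed.

Let hprod_normD x y : hprod_norm (x + y) <= hprod_norm x + hprod_norm y.
Proof.
rewrite -(@ler_pXn2r _ 2)// ?nnegrE ?addr_ge0//.
rewrite hprod_norm_sqr sqrrD !hprod_norm_sqr.
set a := `|x.1|; set b := `|x.2|; set c := `|y.1|; set d := `|y.2|.
have a0 : 0 <= a by exact: normr_ge0.
have b0 : 0 <= b by exact: normr_ge0.
have c0 : 0 <= c by exact: normr_ge0.
have d0 : 0 <= d by exact: normr_ge0.
have le1 : `|(x + y).1| ^+ 2 + `|(x + y).2| ^+ 2 <= (a + c) ^+ 2 + (b + d) ^+ 2.
  by apply: lerD; apply: lerXn2r; rewrite ?nnegrE ?addr_ge0//; exact: ler_normD.
apply: (le_trans le1).
have CS : a * c + b * d <= hprod_norm x * hprod_norm y.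
  rewrite -(@ler_pXn2r _ 2)// ?nnegrE ?addr_ge0 ?mulr_ge0//.
  rewrite exprMn !hprod_norm_sqr -/a -/b -/c -/d -subr_ge0.
  rewrite (_ : _ - _ = (a * d - b * c) ^+ 2); last by ring.
  by rewrite real_exprn_even_ge0// rpredB// rpredM// ger0_real.
have -> : (a + c) ^+ 2 + (b + d) ^+ 2 =
    a ^+ 2 + b ^+ 2 + (a * c + b * d) *+ 2 + (c ^+ 2 + d ^+ 2) by ring.
by rewrite lerD2r lerD2l lerMn2r CS.
Qed.

Let hprod_normZ (l : R[i]) x : hprod_norm (l *: x) = `|l| * hprod_norm x.
Proof.
apply/eqP; rewrite -(@eqrXn2 _ 2)// ?mulr_ge0//; apply/eqP.
by rewrite exprMn !hprod_norm_sqr !normrZ !exprMn mulrDr.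
Qed.

Let hprod_norm0_eq0 x : hprod_norm x = 0 -> x = 0.
Proof.
move=> /(congr1 (fun z => z ^+ 2)); rewrite hprod_norm_sqr expr0n/= => /eqP.
rewrite paddr_eq0 ?exprn_ge0// !expf_eq0/= !normr_eq0 => /andP[/eqP x1 /eqP x2].
by case: x x1 x2 => [a b]/= -> ->.
Qed.

HB.instance Definition _ :=
  Lmodule_isNormed.Build R[i] H hprod_normD hprod_normZ hprod_norm0_eq0.

Let ler_norm_hprod1 (x : H) : `|x.1| <= `|x|.
Proof.
by rewrite -(@ler_pXn2r _ 2)// ?nnegrE// hprod_norm_sqr lerDl exprn_ge0.
Qed.

Let ler_norm_hprod2 (x : H) : `|x.2| <= `|x|.
Proof.
by rewrite -(@ler_pXn2r _ 2)// ?nnegrE// hprod_norm_sqr lerDr exprn_ge0.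
Qed.

Let ler_norm_hprod (x : H) : `|x| <= `|x.1| + `|x.2|.
Proof.
rewrite -(@ler_pXn2r _ 2)// ?nnegrE ?addr_ge0// hprod_norm_sqr sqrrD.
by rewrite addrAC lerDl mulrn_wge0// mulr_ge0.
Qed.

Let cauchy_hprod_image (H0 : hilbertType R) (p : H -> H0) (F : set_system H) :
  (forall x y, `|p x - p y| <= `|x - y|) ->
  ProperFilter F -> cauchy F -> cauchy (p @ F).
Proof.
move=> pB FF /cauchyP Fc; apply/cauchyP => e e0.
have [x Fx] := Fc e e0; exists (p x).
apply: (@filterS _ F _ (ball x e) (p @^-1` ball (p x) e)) Fx => y; rewrite /= -!ball_normE/= => xy.
by apply: le_lt_trans xy; exact: pB.
Qed.

Let hprod_complete (F : set_system H) : ProperFilter F -> cauchy F -> cvg F.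
Proof.
move=> FF Fc.
have /cvg_ex[l1 F1] : cvg ((fst : H -> H1) @ F).
  by apply: cauchy_cvg; apply: cauchy_hprod_image => // x y;
     exact: (ler_norm_hprod1 (x - y)).
have /cvg_ex[l2 F2] : cvg ((snd : H -> H2) @ F).
  by apply: cauchy_cvg; apply: cauchy_hprod_image => // x y;
     exact: (ler_norm_hprod2 (x - y)).
apply/cvg_ex; exists ((l1, l2) : H); apply/cvgrPdist_lt => e e0.
have e20 : 0 < e / 2 by rewrite divr_gt0.
have /cvgrPdist_lt/(_ _ e20) G1 := F1.
have /cvgrPdist_lt/(_ _ e20) G2 := F2.
apply: filterS2 G1 G2 => x x1 x2.
apply: le_lt_trans (ler_norm_hprod _) _.
by rewrite (splitr e) ltrD.
Qed.

HB.instance Definition _ := isPointed.Build H 0.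
HB.instance Definition _ := Uniform_isComplete.Build H hprod_complete.

Definition hprod_inner (x y : H) : R[i] := inner x.1 y.1 + inner x.2 y.2.

Let hprod_inner_linearl y : linear_for *%R (hprod_inner^~ y).
Proof.
move=> a u v; rewrite /hprod_inner/= !inner_linearl mulrDr.
by rewrite -!addrA; congr (_ + _); rewrite addrCA.
Qed.

Let hprod_innerC x y : hprod_inner x y = Num.conj (hprod_inner y x).
Proof. by rewrite /hprod_inner rmorphD/= innerC [in LHS](innerC x.2). Qed.

Let hprod_inner_norm x : hprod_inner x x = `|x| ^+ 2.
Proof. by rewrite /hprod_inner !inner_norm hprod_norm_sqr. Qed.

HB.instance Definition _ := CompleteNormedModule_isHilbert.Build R H
  hprod_inner_linearl hprod_innerC hprod_inner_norm.

End HilbertProduct.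

(* A linear operator defined on a vector subspace: a total function of which
   only the values on [dom] are meaningful. *)
Record partial_linear (K : pzRingType) (U V : lmodType K) := PartialLinear {
  dom : set U ;
  pl_fun :> U -> V ;
  dom0 : dom 0 ;
  domP : forall a x y, dom x -> dom y -> dom (a *: x + y) ;
  pl_funP : forall a x y, dom x -> dom y ->
    pl_fun (a *: x + y) = a *: pl_fun x + pl_fun y
}.

Section Operators.
Variables (R : realType) (H : hilbertType R).

Definition bounded_operator (f : H -> H) :=
  exists M : R, forall x, `|f x| <= M%:C%C * `|x|.

Definition coercive (f : H -> H) :=
  exists2 nu : R, 0 < nu &
    forall h, nu%:C%C * `|h| ^+ 2 <= 'Re (inner h (f h)).

(* Only the values at nonnegative times are relevant. *)
Definition C0_semigroup (T : R -> {linear H -> H}) :=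
  [/\ forall t, 0 <= t -> bounded_operator (T t),
      forall x, T 0 x = x,
      forall s t x, 0 <= s -> 0 <= t -> T (s + t) x = T s (T t x) &
      forall x, T t x @[t --> 0^'+] --> x].

Definition contractive (T : R -> {linear H -> H}) :=
  forall t, 0 <= t -> forall x, `|T t x| <= `|x|.

Definition difference_quotient (T : R -> {linear H -> H}) (x : H) (t : R) : H :=
  (t^-1)%:C%C *: (T t x - x).

Definition is_generator (A : partial_linear H H) (T : R -> {linear H -> H}) :=
  (forall x, dom A x <-> cvg (difference_quotient T x t @[t --> 0^'+])) /\
  (forall x, dom A x -> difference_quotient T x t @[t --> 0^'+] --> A x).

Definition generates_contractive_C0_semigroup (A : partial_linear H H) :=
  exists T, [/\ C0_semigroup T, contractive T & is_generator A T].

Definition resolvent_set (A : partial_linear H H) : set R[i] :=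
  [set l | exists B : {linear H -> H}, [/\ bounded_operator B,
     forall y, dom A (B y) /\ l *: B y - A (B y) = y &
     forall x, dom A x -> B (l *: x - A x) = x]].

Definition spectrum (A : partial_linear H H) : set R[i] := ~` resolvent_set A.

End Operators.

Definition imaginary_axis (R : realType) : set R[i] :=
  range (fun w : R => 0 +i* w)%C.
Arguments imaginary_axis : clear implicits.

Section ExtendedOperators.
Variables (R : realType) (H1 H2 : hilbertType R).
Variables (A1 : partial_linear (hprod H1 H2) H1) (A21 : partial_linear H1 H2).
Variable S : {linear H2 -> H2}.
Local Notation H := (hprod H1 H2).

Definition dom_ext : set H := [set h | dom A1 h /\ dom A21 h.1].

Definition fun_ext (h : H) : H := (A1 h, A21 h.1).

Let dom_ext0 : dom_ext 0.
Proof. by split; exact: dom0. Qed.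

Let dom_extP a x y : dom_ext x -> dom_ext y -> dom_ext (a *: x + y).
Proof. by move=> [x1 x2] [y1 y2]; split; exact: domP. Qed.

Let fun_extP a x y : dom_ext x -> dom_ext y ->
  fun_ext (a *: x + y) = a *: fun_ext x + fun_ext y.
Proof. by move=> [x1 x2] [y1 y2]; rewrite /fun_ext !pl_funP. Qed.

Definition A_ext : partial_linear H H :=
  PartialLinear dom_ext0 dom_extP fun_extP.

Definition graph_S (h : H1) : H := (h, S (A21 h)).

Definition dom_S : set H1 := [set h | dom A21 h /\ dom A1 (graph_S h)].

Definition fun_S (h : H1) : H1 := A1 (graph_S h).

Let graph_SP a x y : dom A21 x -> dom A21 y ->
  graph_S (a *: x + y) = a *: graph_S x + graph_S y.
Proof. by move=> x1 y1; rewrite /graph_S pl_funP// linearP. Qed.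

Let dom_S0 : dom_S 0.
Proof.
split; first exact: dom0.
have -> : graph_S 0 = 0; last exact: dom0.
have := graph_SP (-1) (dom0 A21) (dom0 A21).
by rewrite scaler0 addr0 scaleN1r addNr.
Qed.

Let dom_SP a x y : dom_S x -> dom_S y -> dom_S (a *: x + y).
Proof.
move=> [x1 x2] [y1 y2]; split; first exact: domP.
by rewrite graph_SP//; exact: domP.
Qed.

Let fun_SP a x y : dom_S x -> dom_S y ->
  fun_S (a *: x + y) = a *: fun_S x + fun_S y.
Proof. by move=> [x1 x2] [y1 y2]; rewrite /fun_S graph_SP// pl_funP. Qed.

Definition A_S : partial_linear H1 H1 := PartialLinear dom_S0 dom_SP fun_SP.

End ExtendedOperators.

(* Main.v *)
Require Import Defs.
From HB Require Import structures.
From mathcomp Require Import all_boot all_order all_algebra.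
From mathcomp Require Import complex ring lra.
From mathcomp Require Import boolp classical_sets functions filter reals topology.
From mathcomp Require Import normedtype.

Set Implicit Arguments.
Unset Strict Implicit.
Unset Printing Implicit Defensive.

Import Order.TTheory GRing.Theory Num.Theory numFieldNormedType.Exports.

Local Open Scope classical_set_scope.
Local Open Scope ring_scope.

(** Let [l] be purely imaginary and in the resolvent set of the extended
    operator [A].  Solving [l h - A_S h = f] amounts to finding [x = (h, S k)],
    [k = A21 h], in the domain of [A]; the second component of [l x - A x] is
    then [l S k - k], so that with the bounded operator
    [P (x1, x2) = (0, S^-1 x2 - l x2)] the equation reads
    [l x - A x + P x = (f, 0)].  It thus suffices to show that [l - A + P] is
    bijective with bounded inverse.

    Coercivity of [S] passes to [S^-1], and since [Re l = 0] the term [- l x2]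
    does not contribute to [Re (P x | x)]; hence
    [Re (P x | x) >= mu |P x|^2] for some [mu > 0]
    ([diag_perturbation_cocoercive]).  As [A] generates a contraction
    semigroup, [Re (A x | x) <= 0] ([generator_dissipative]).  For [t] in
    [[0, 1]] and [g = l x - A x + t P x] this gives
    [mu |t P x|^2 <= |g| |x|]: the perturbation is controlled by the data.
    Together with [|x| <= C |l x - A x| <= C (|g| + |t P x|)], where [C] bounds
    the resolvent, this yields [|x| <= M |g|] with [M] independent of [t]
    ([perturbed_bound]).

    With such a uniform bound the method of continuity
    ([continuation_surjective]) carries surjectivity from [t = 0], where it is
    the hypothesis on [l], to [t = 1].  The same method, applied along the
    segment from the identity to [S], shows that the coercive operator [S] is
    invertible in the first place ([coercive_surjective]). *)

(** * Real-valued norms *)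

Section RealNorm.
Variables (R : realType) (V : normedModType R[i]).
Implicit Types x y : V.

(** The norm of a complex space takes its values in [R[i]], whose order is
    partial; estimates are carried out on this real copy of it. *)
Definition rnorm x : R := complex.Re `|x|.

Lemma rnormE x : `|x| = (rnorm x)%:C%C.
Proof. by rewrite /rnorm RRe_real// ger0_real. Qed.

Lemma rnorm_ge0 x : 0 <= rnorm x.
Proof. by rewrite -ler0c -rnormE. Qed.

Lemma rnormD x y : rnorm (x + y) <= rnorm x + rnorm y.
Proof. by rewrite -lecR rmorphD/= -!rnormE ler_normD. Qed.

Lemma rnormN x : rnorm (- x) = rnorm x.
Proof. by rewrite /rnorm normrN. Qed.

Lemma rnormB x y : rnorm (x - y) <= rnorm x + rnorm y.
Proof. by rewrite (le_trans (rnormD _ _))// rnormN. Qed.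

Lemma rnorm_distC x y : rnorm (x - y) = rnorm (y - x).
Proof. by rewrite -rnormN opprB. Qed.

Lemma rnormZ (a : R[i]) x : rnorm (a *: x) = complex.Re `|a| * rnorm x.
Proof.
apply: complexI; rewrite rmorphM/= -!rnormE normrZ.
exact: erefl.
Qed.

Lemma rnormZ_real (a : R) x : 0 <= a -> rnorm (a%:C%C *: x) = a * rnorm x.
Proof. by move=> a0; rewrite rnormZ ger0_norm// ler0c. Qed.

Lemma rnorm0 : rnorm 0 = 0.
Proof. by rewrite /rnorm normr0. Qed.

Lemma rnorm_le0 x : rnorm x <= 0 -> x = 0.
Proof.
move=> x0; apply/normr0_eq0; rewrite rnormE.
by have -> : rnorm x = 0 by apply/le_anti; rewrite x0 rnorm_ge0.
Qed.

End RealNorm.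

Lemma bounded_rnormP (R : realType) (V W : normedModType R[i]) (f : V -> W) :
  (exists M : R, forall x, `|f x| <= M%:C%C * `|x|) <->
  exists2 K : R, 0 < K & forall x, rnorm (f x) <= K * rnorm x.
Proof.
split=> [[M Mf]|[K _ Kf]]; last first.
  by exists K => x; rewrite !rnormE -rmorphM/= lecR.
exists (`|M| + 1) => [|x]; first by rewrite ltr_wpDl.
have := Mf x; rewrite !rnormE -rmorphM/= lecR => /le_trans; apply.
by rewrite ler_wpM2r ?rnorm_ge0// (le_trans (ler_norm M))// lerDl.
Qed.

(** * The method of continuity *)

Section Continuation.
Variables (R : realType) (V : completeNormedModType R[i]).

Lemma cvg_rnorm (T : Type) (F : set_system T) {FF : Filter F} (f : T -> V) l :
  f @ F --> l <-> forall e : R, 0 < e -> F [set t | rnorm (l - f t) < e].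
Proof.
split=> [/cvgrPdist_lt fl e e0|fl].
  have := fl e%:C%C; rewrite ltcR => /(_ e0); apply: filterS => t /=.
  by rewrite rnormE ltcR.
apply/cvgrPdist_lt => e e0.
have eE : e = (complex.Re e)%:C%C by rewrite RRe_real// gtr0_real.
have := fl (complex.Re e); rewrite -ltcR -eE => /(_ e0); apply: filterS => t /=.
by rewrite -ltcR -rnormE -eE.
Qed.

(** Banach's fixed point theorem over complex scalars; the ratio [1 / 2] keeps
    the geometric series explicit. *)
Lemma half_contraction_fixed_point (f : V -> V) :
  (forall x y, rnorm (f x - f y) <= rnorm (x - y) / 2) -> exists x, f x = x.
Proof.
move=> fc; pose y n := iter n f 0; pose c := rnorm (f 0).
have c0 : 0 <= c by exact: rnorm_ge0.
have step n : rnorm (y n - y n.+1) <= c / 2 ^+ n.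
  elim: n => [|n IH]; first by rewrite /= sub0r rnormN expr0 divr1.
  apply: le_trans (fc _ _) _; rewrite exprSr invfM mulrA.
  by rewrite ler_wpM2r// invr_ge0.
(* The tail of the geometric series, written so that it telescopes in [m]. *)
have tele n m :
    rnorm (y n - y (n + m)%N) <= 2 * c / 2 ^+ n - 2 * c / 2 ^+ (n + m).
  elim: m => [|m IH]; first by rewrite addn0 !subrr rnorm0.
  have := rnormD (y n - y (n + m)%N) (y (n + m)%N - y (n + m).+1).
  rewrite addrA subrK addnS => /le_trans; apply.
  apply: le_trans (lerD IH (step _)) _.
  have -> : 2 * c / 2 ^+ (n + m).+1 = c / 2 ^+ (n + m).
    by rewrite exprS -mulf_div divff ?mul1r// pnatr_eq0.
  rewrite -[2 * c / 2 ^+ (n + m)]mulrA; move: (c / _) => z.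
  lra.
have small (e : R) : 0 < e -> exists N, 2 * c / 2 ^+ N < e.
  move=> e0; exists (Num.bound (2 * c / e)); set N := Num.bound _.
  rewrite ltr_pdivrMr ?exprn_gt0// [e * _]mulrC -ltr_pdivrMr//.
  have ce0 : 0 <= 2 * c / e by rewrite divr_ge0 ?mulr_ge0// ltW.
  apply: lt_trans (archi_boundP ce0) _.
  by rewrite -natrX ltr_nat ltn_expl.
have tail (e : R) : 0 < e ->
    exists N, forall n, (N <= n)%N -> rnorm (y N - y n) < e.
  move=> /small[N Ne]; exists N => n Nn; rewrite -(subnKC Nn).
  apply: le_lt_trans (tele _ _) _; apply: le_lt_trans Ne.
  by rewrite gerBl divr_ge0 ?mulr_ge0// exprn_ge0.
have /cvg_ex[l yl] : cvg (y @ \oo).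
  apply: cauchy_cvg; apply/cauchyP => e e0.
  have eE : e = (complex.Re e)%:C%C by rewrite RRe_real// gtr0_real.
  have [|N Ny] := tail (complex.Re e); first by rewrite -ltcR -eE.
  exists (y N); exists N => // n Nn; rewrite /= -ball_normE/= rnormE eE ltcR.
  exact: Ny.
exists l; apply/subr0_eq; apply/rnorm_le0; apply/ler_addgt0Pr => e e0.
have e20 : 0 < e / 2 by rewrite divr_gt0.
have /cvg_rnorm/(_ _ e20)[N _ Nl] := yl.
rewrite add0r.
have l1 : rnorm (l - y N) < e / 2 by apply: Nl => /=.
have l2 : rnorm (l - y N.+1) < e / 2 by apply: Nl => /=.
have fl : rnorm (f l - y N.+1) <= rnorm (l - y N) / 2 by exact: fc.
have := rnormD (f l - y N.+1) (y N.+1 - l).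
rewrite addrA subrK [rnorm (y N.+1 - l)]rnorm_distC => h.
have := rnorm_ge0 (l - y N); lra.
Qed.

(** If [I + t Q] is onto, the lower bound makes its inverse [M]-Lipschitz, so
    [I + (t + d) Q] is onto as soon as [M d K <= 1 / 2]: the equation
    [x + (t + d) Q x = y] is the fixed point equation of
    [x |-> (I + t Q)^-1 (y - d Q x)].  The admissible [d] does not depend on
    [t], hence finitely many steps lead from [0] to [1]. *)
Lemma continuation_surjective (Q : {linear V -> V}) (K M : R) :
  0 <= K -> 0 <= M -> (forall x, rnorm (Q x) <= K * rnorm x) ->
  (forall (t : R) x, 0 <= t <= 1 -> rnorm x <= M * rnorm (x + t%:C%C *: Q x)) ->
  forall y, exists x, x + Q x = y.
Proof.
move=> K0 M0 QK QM.
pose n := (Num.bound (2 * M * K)).+1.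
have n0 : 0 < n%:R :> R by [].
have MKn : 2 * M * K <= n%:R.
  have MK0 : 0 <= 2 * M * K by rewrite !mulr_ge0.
  by rewrite (le_trans (ltW (archi_boundP MK0)))// ler_nat.
pose d : R := n%:R^-1.
have d0 : 0 <= d by rewrite invr_ge0 ltW.
have MKd : M * (d * K) <= 1 / 2.
  have -> : M * (d * K) = (2 * M * K) / n%:R / 2.
    by rewrite /d; field; rewrite gt_eqF.
  by rewrite ler_wpM2r ?invr_ge0// ler_pdivrMr ?mul1r.
suff Qn k : (k <= n)%N -> forall y, exists x, x + (k%:R * d)%:C%C *: Q x = y.
  by move=> y; have [x xy] := Qn n (leqnn n) y; exists x;
     rewrite divff ?gt_eqF// scale1r in xy.
elim: k => [_ y|k IH kn y].
  by exists y; rewrite mul0r scale0r addr0.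
have [G GE] := choice (IH (ltnW kn)).
have kd1 : 0 <= k%:R * d <= 1.
  by rewrite mulr_ge0//= /d ler_pdivrMr// mul1r ler_nat ltnW.
have GM u v : rnorm (G u - G v) <= M * rnorm (u - v).
  apply: le_trans (QM _ _ kd1) _; rewrite linearB scalerBr.
  by rewrite addrACA -opprD !GE.
have [|x xE] := @half_contraction_fixed_point (fun x => G (y - d%:C%C *: Q x)).
  move=> x x'; apply: le_trans (GM _ _) _.
  rewrite opprB addrC addrA subrK -scalerBr -linearB rnormZ_real//.
  rewrite [rnorm (x - _)]rnorm_distC.
  have dQ := ler_wpM2l d0 (QK (x' - x)).
  have := ler_wpM2r (rnorm_ge0 (x' - x)) MKd; rewrite -!mulrA.
  have := ler_wpM2l M0 dQ; lra.
exists x; have := GE (y - d%:C%C *: Q x); rewrite xE => xQ.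
by rewrite -natr1 mulrDl mul1r rmorphD/= scalerDl addrA xQ subrK.
Qed.

End Continuation.

(** * The real part of the inner product *)

Section RealInner.
Variables (R : realType) (H : hilbertType R).
Implicit Types x y z : H.

Definition rinner x y : R := complex.Re (inner x y).

Lemma rinnerC x y : rinner x y = rinner y x.
Proof.
rewrite /rinner innerC; apply: complexI; rewrite !complexRe.
by rewrite Re_conj.
Qed.

Lemma rinnerDl x y z : rinner (x + y) z = rinner x z + rinner y z.
Proof.
have := inner_linearl z 1 x y; rewrite scale1r mul1r /rinner => ->.
by rewrite raddfD.
Qed.

Lemma innerZl (a : R[i]) x y : inner (a *: x) y = a * inner x y.
Proof.
have i0 : inner 0 y = 0.
  have := inner_linearl y 1 0 0; rewrite scale1r mul1r addr0 => /eqP.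
  by rewrite -subr_eq subrr => /eqP.
by have := inner_linearl y a x 0; rewrite /= !addr0 i0 addr0.
Qed.

Lemma rinnerZl (a : R) x y : rinner (a%:C%C *: x) y = a * rinner x y.
Proof. by rewrite /rinner innerZl; case: (inner x y) => b c /=; ring. Qed.

Lemma rinnerNl x y : rinner (- x) y = - rinner x y.
Proof. by rewrite -scaleN1r -(rmorphN1 (real_complex R)) rinnerZl mulN1r. Qed.

Lemma rinnerBl x y z : rinner (x - y) z = rinner x z - rinner y z.
Proof. by rewrite rinnerDl rinnerNl. Qed.

Lemma rinnerxx x : rinner x x = rnorm x ^+ 2.
Proof. by rewrite /rinner inner_norm rnormE -rmorphXn. Qed.

Lemma rinnerZxx (a : R[i]) x : rinner (a *: x) x = complex.Re a * rnorm x ^+ 2.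
Proof.
rewrite /rinner innerZl inner_norm rnormE -rmorphXn/=.
by case: a => b c /=; ring.
Qed.

Lemma rinner0l x : rinner 0 x = 0.
Proof. by rewrite -(scale0r x) rinnerZxx mul0r. Qed.

Lemma rnormD_sqr x y :
  rnorm (x + y) ^+ 2 = rnorm x ^+ 2 + 2 * rinner x y + rnorm y ^+ 2.
Proof.
rewrite -!rinnerxx rinnerDl ![rinner _ (x + y)]rinnerC !rinnerDl.
by rewrite (rinnerC y x); ring.
Qed.

(** Cauchy-Schwarz, read off from expanding the square of the triangle
    inequality. *)
Lemma rinner_le x y : rinner x y <= rnorm x * rnorm y.
Proof.
have := rnormD_sqr x y.
have := rnormD x y; have := rnorm_ge0 (x + y).
have := rnorm_ge0 x; have := rnorm_ge0 y; nra.
Qed.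

End RealInner.

(** * Generators and resolvents *)

(** How coercivity turns into a lower bound: with Cauchy-Schwarz, one factor
    [a] of the quadratic inequality cancels. *)
Lemma ler_div_of_sqr (R : realFieldType) (mu a b : R) :
  0 < mu -> 0 <= a -> 0 <= b -> mu * a ^+ 2 <= b * a -> a <= mu^-1 * b.
Proof.
move=> mu0 a0 b0 ab; have [->|a1] := eqVneq a 0.
  by rewrite mulr_ge0// invr_ge0 ltW.
have {}a0 : 0 < a by rewrite lt_def a1.
by rewrite mulrC ler_pdivlMr// mulrC -(ler_pM2r a0) -mulrA -expr2.
Qed.

Section Generators.
Variables (R : realType) (H : hilbertType R).
Implicit Types (A : partial_linear H H) (l : R[i]).

Definition dissipative A := forall x, dom A x -> rinner (A x) x <= 0.

(** By contractivity [Re (T t x | x) <= |x|^2], so the difference quotients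
    satisfy the inequality, which is preserved in the limit. *)
Lemma generator_dissipative A :
  generates_contractive_C0_semigroup A -> dissipative A.
Proof.
move=> [T [_ Tc [_ TA]]] x /TA/cvg_rnorm quot; rewrite leNgt; apply/negP => Ax0.
have x1 : 0 < rnorm x + 1 by rewrite ltr_wpDl// rnorm_ge0.
have [t /= t0 At] : exists2 t : R, 0 < t &
    rnorm (A x - difference_quotient T x t) < rinner (A x) x / (rnorm x + 1).
  have e0 : 0 < rinner (A x) x / (rnorm x + 1) by rewrite divr_gt0.
  have near0 := quot _ e0.
  have pos0 : (0 : R)^'+ [set t | 0 < t] by exact: nbhs_right_gt.
  by have [t [? ?]] := filter_ex (filterI pos0 near0); exists t.
have quot_le0 : rinner (difference_quotient T x t) x <= 0.
  rewrite rinnerZl rinnerBl rinnerxx.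
  apply: mulr_ge0_le0; first by rewrite invr_ge0 ltW.
  rewrite subr_le0; apply: le_trans (rinner_le _ _) _.
  rewrite expr2 ler_wpM2r ?rnorm_ge0//.
  by rewrite -lecR -!rnormE Tc// ltW.
have := rinner_le (A x - difference_quotient T x t) x; rewrite rinnerBl.
move: At; rewrite ltr_pdivlMr//.
have := rnorm_ge0 (A x - difference_quotient T x t); nra.
Qed.

(** The lower bound gives uniqueness of the solution and boundedness of the
    solution operator; linearity follows from uniqueness. *)
Lemma resolvent_set_of_lower_bound A l :
  (forall y, exists x, dom A x /\ l *: x - A x = y) ->
  (exists2 M : R, 0 < M &
     forall x, dom A x -> rnorm x <= M * rnorm (l *: x - A x)) ->
  resolvent_set A l.
Proof.
move=> surj [M M0 bound].
have shift_lin a x y : dom A x -> dom A y ->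
    l *: (a *: x + y) - A (a *: x + y) = a *: (l *: x - A x) + (l *: y - A y).
  move=> dx dy; rewrite pl_funP// !scalerDr scalerN !scalerA (mulrC l a).
  by rewrite opprD addrACA.
have inj x x' : dom A x -> dom A x' -> l *: x - A x = l *: x' - A x' -> x = x'.
  move=> dx dx' xx'; apply/subr0_eq/rnorm_le0.
  have := bound _ (domP (-1) dx' dx); rewrite shift_lin// xx'.
  by rewrite !scaleN1r addNr rnorm0 mulr0 addrC.
have [B BP] := choice surj.
have Blin a : {morph B : x y / a *: x + y}.
  move=> x y; have [[dx Ex] [dy Ey]] := (BP x, BP y).
  have [dxy Exy] := BP (a *: x + y).
  by apply: inj => //; [exact: domP | rewrite Exy shift_lin// Ex Ey].
pose B' : {linear H -> H} := HB.pack B (GRing.isLinear.Build _ _ _ _ B Blin).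
exists B'; split.
- apply/bounded_rnormP; exists M => // y; have [dx Ex] := BP y.
  by have := bound _ dx; rewrite Ex.
- exact: BP.
- by move=> x dx; have [dx' Ex'] := BP (l *: x - A x); exact: inj.
Qed.

(** Pairing the right-hand side [g] with [x] bounds [mu |t P x|^2] by
    [|g| |x|], where [t <= 1] allows one to trade [t] for [t ^+ 2].  The
    arithmetic-geometric mean inequality then absorbs the resulting fraction of
    [|x|].  The constant must not depend on [t], as required by the method of
    continuity. *)
Lemma perturbed_bound A l (C mu : R) (P : H -> H) :
  dissipative A -> 0 <= complex.Re l -> 0 <= C -> 0 < mu ->
  (forall x, dom A x -> rnorm x <= C * rnorm (l *: x - A x)) ->
  (forall x, mu * rnorm (P x) ^+ 2 <= rinner (P x) x) ->
  forall (t : R) x, 0 <= t <= 1 -> dom A x ->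
    rnorm x <= 2 * (C + C ^+ 2 / mu) * rnorm (l *: x - A x + t%:C%C *: P x).
Proof.
move=> Adiss l0 C0 mu0 bound Pmu t x /andP[t0 t1] dx.
set g := l *: x - A x + _; have gx := rinner_le g x.
have Px : mu * (t * rnorm (P x)) ^+ 2 <= rnorm g * rnorm x.
  apply: le_trans gx; rewrite /g rinnerDl rinnerBl rinnerZxx rinnerZl.
  have := Adiss _ dx; have := mulr_ge0 l0 (sqr_ge0 (rnorm x)).
  have := ler_wpM2l t0 (Pmu x).
  have : 0 <= t * (1 - t) * (mu * rnorm (P x) ^+ 2).
    apply: mulr_ge0; first by rewrite mulr_ge0 ?subr_ge0.
    by rewrite mulr_ge0 ?sqr_ge0 ?ltW.
  nra.
have xg : rnorm x <= C * (rnorm g + t * rnorm (P x)).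
  apply: le_trans (bound _ dx) _; rewrite ler_wpM2l//.
  have -> : l *: x - A x = g - t%:C%C *: P x by rewrite /g addrK.
  by rewrite (le_trans (rnormB _ _))// rnormZ_real.
have q0 : 0 <= t * rnorm (P x) by rewrite mulr_ge0 ?rnorm_ge0.
move: (t * _) Px xg q0 => q Px xg q0.
have x0 := rnorm_ge0 x; have g0 := rnorm_ge0 g.
move: (rnorm x) (rnorm g) Px xg x0 g0 => a b Px xg a0 b0.
pose k := C ^+ 2 / mu; rewrite -/k.
have k0 : 0 <= k by rewrite divr_ge0 ?sqr_ge0 ?ltW.
have Ck : C ^+ 2 = k * mu by rewrite /k divfK// gt_eqF.
have Cb := mulr_ge0 C0 b0; have kb := mulr_ge0 k0 b0.
(* AM-GM for [a] and [4 * k * b], whose geometric mean dominates [2 * C * q]. *)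
have amgm : 2 * (C * q) <= (a + 4 * (k * b)) / 2.
  have Cq := mulr_ge0 C0 q0.
  rewrite -ler_sqr ?nnegrE; [|lra|lra].
  have -> : (2 * (C * q)) ^+ 2 = 4 * (k * (mu * q ^+ 2)).
    by rewrite !exprMn Ck; ring.
  have := ler_wpM2l k0 Px; have := sqr_ge0 (a - 4 * (k * b)).
  nra.
rewrite mulrDr in xg; rewrite -mulrA mulrDl.
lra.
Qed.

(** Substituting [x = B f] with [B] the resolvent turns [l - A + t P] into
    [I + t P B], to which the method of continuity applies: there is a uniform
    bound for [x], hence for [P x], hence for [f]. *)
Lemma cocoercive_perturbation A l (P : {linear H -> H}) (mu : R) :
  dissipative A -> resolvent_set A l -> 0 <= complex.Re l -> 0 < mu ->
  (forall x, mu * rnorm (P x) ^+ 2 <= rinner (P x) x) ->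
  (forall y, exists x, dom A x /\ l *: x - A x + P x = y) /\
  exists2 M : R, 0 < M &
    forall x, dom A x -> rnorm x <= M * rnorm (l *: x - A x + P x).
Proof.
move=> Adiss [B [/bounded_rnormP[C C0 BC] BR BL]] l0 mu0 Pmu.
have bound x : dom A x -> rnorm x <= C * rnorm (l *: x - A x).
  by move=> dx; rewrite -[in leLHS](BL x dx).
pose M := 2 * (C + C ^+ 2 / mu).
have M0 : 0 < M by rewrite mulr_gt0// addr_gt0// divr_gt0// exprn_gt0.
have unif : forall (t : R) x, 0 <= t <= 1 -> dom A x ->
    rnorm x <= M * rnorm (l *: x - A x + t%:C%C *: P x).
  exact: perturbed_bound (ltW C0) _ _ _.
split; last first.
  exists M => // x dx; have := unif 1 x; rewrite scale1r ler01 lexx; exact.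
have P_le x : rnorm (P x) <= mu^-1 * rnorm x.
  apply: ler_div_of_sqr; rewrite ?rnorm_ge0//.
  by apply: le_trans (Pmu x) _; rewrite mulrC rinner_le.
have BK y : rnorm (P (B y)) <= mu^-1 * C * rnorm y.
  by rewrite (le_trans (P_le _))// -mulrA ler_wpM2l// invr_ge0 ltW.
have mu'0 : 0 <= mu^-1 by rewrite invr_ge0 ltW.
(* [1 + mu^-1 * M]: from [f = g - t P x] one has [|f| <= |g| + |P x|], while
   [|P x| <= mu^-1 |x| <= mu^-1 M |g|]. *)
have surj := @continuation_surjective _ _ (P \o B : {linear H -> H})
  (mu^-1 * C) (1 + mu^-1 * M) _ _ BK.
move=> y; have [||t f /andP[t0 t1]|f fy] := surj _ _ _ y.
- by rewrite mulr_ge0// ltW.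
- by rewrite addr_ge0// mulr_ge0// ltW.
- have [dx Ex] := BR f.
  have := unif t (B f); rewrite Ex t0 t1 => /(_ isT dx) /=.
  set g := f + _ => xg.
  have -> : f = g - t%:C%C *: P (B f) by rewrite /g addrK.
  apply: le_trans (rnormB _ _) _; rewrite rnormZ_real// mulrDl mul1r lerD2l.
  apply: (@le_trans _ _ (rnorm (P (B f)))).
    by rewrite ler_piMl// rnorm_ge0.
  by rewrite (le_trans (P_le _))// -mulrA ler_wpM2l.
- have [dx Ex] := BR f; exists (B f); split=> //.
  by rewrite Ex.
Qed.

Lemma coercive_rinner (S : H -> H) : coercive S ->
  exists2 nu : R, 0 < nu & forall x, nu * rnorm x ^+ 2 <= rinner (S x) x.
Proof.
move=> [nu nu0 Snu]; exists nu => // x; rewrite rinnerC -lecR.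
by rewrite rmorphM rmorphXn/= -rnormE complexRe.
Qed.

(** The operators [(1 - t) I + t S] are all coercive with the constant
    [Num.min 1 nu], hence uniformly bounded below; this is the operator case of
    the Lax-Milgram theorem. *)
Lemma coercive_surjective (S : {linear H -> H}) :
  bounded_operator S -> coercive S -> forall y, exists x, S x = y.
Proof.
move=> /bounded_rnormP[K K0 SK] /coercive_rinner[nu nu0 Snu] y.
pose m := Num.min 1 nu.
have m0 : 0 < m by rewrite lt_min ltr01.
have m1 : m <= 1 by rewrite ge_min lexx.
have mnu : m <= nu by rewrite ge_min lexx orbT.
have [||x|t x /andP[t0 t1]|x xy] :=
    @continuation_surjective _ _ (S \- idfun : {linear H -> H})
      (K + 1) m^-1 _ _ _ _ y.
- by rewrite addr_ge0 ?ltW.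
- by rewrite invr_ge0 ltW.
- by rewrite /= mulrDl mul1r (le_trans (rnormB _ _))// lerD2r.
- apply: ler_div_of_sqr; rewrite ?rnorm_ge0//=; apply: le_trans (rinner_le _ _).
  rewrite rinnerDl rinnerZl rinnerBl rinnerxx.
  have := ler_wpM2l t0 (Snu x); have := sqr_ge0 (rnorm x).
  have : 0 <= t * (nu - m) * rnorm x ^+ 2.
    by rewrite mulr_ge0 ?sqr_ge0// mulr_ge0// subr_ge0.
  have : 0 <= (1 - t) * (1 - m) * rnorm x ^+ 2.
    by rewrite mulr_ge0 ?sqr_ge0// mulr_ge0// subr_ge0.
  nra.
- by exists x; rewrite -xy /= addrC subrK.
Qed.

Lemma coercive_bounded_below (S : H -> H) (nu : R) : 0 < nu ->
  (forall x, nu * rnorm x ^+ 2 <= rinner (S x) x) ->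
  forall x, rnorm x <= nu^-1 * rnorm (S x).
Proof.
move=> nu0 Snu x; apply: ler_div_of_sqr; rewrite ?rnorm_ge0//.
exact: le_trans (Snu x) (rinner_le _ _).
Qed.

End Generators.

(** * The perturbation that eliminates the second component *)

Section DiagonalPerturbation.
Variables (R : realType) (H1 H2 : hilbertType R).
Variables (Sinv : {linear H2 -> H2}) (l : R[i]).
Local Notation H := (hprod H1 H2).

Definition diag_perturbation (x : H) : H := (0, Sinv x.2 - l *: x.2).

Lemma diag_perturbation_linear : linear diag_perturbation.
Proof.
move=> a x y; rewrite /diag_perturbation.
rewrite -[RHS]/(a *: 0 + 0, a *: (Sinv x.2 - l *: x.2) + (Sinv y.2 - l *: y.2)).
rewrite scaler0 addr0; congr pair.
by rewrite linearP scalerBr scalerDr !scalerA mulrC opprD addrACA.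
Qed.

HB.instance Definition _ :=
  GRing.isLinear.Build R[i] H H _ diag_perturbation diag_perturbation_linear.

Lemma rnorm_hprod_sqr (x : H) : rnorm x ^+ 2 = rnorm x.1 ^+ 2 + rnorm x.2 ^+ 2.
Proof. by rewrite -!rinnerxx /rinner -raddfD. Qed.

Lemma rnorm_hprod_fst (x : H) : rnorm x.1 <= rnorm x.
Proof.
by rewrite -ler_sqr ?nnegrE ?rnorm_ge0// rnorm_hprod_sqr lerDl sqr_ge0.
Qed.

Lemma rnorm_hprod_pair0 (x : H1) : rnorm ((x, 0) : H) = rnorm x.
Proof.
apply/eqP; rewrite -(@eqrXn2 _ 2) ?rnorm_ge0//.
by rewrite rnorm_hprod_sqr rnorm0 expr0n addr0.
Qed.

(** Both sides depend on [x.2] alone, and a purely imaginary [l] drops out of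
    the real part of the inner product. *)
Lemma diag_perturbation_cocoercive (C nu : R) : 0 < C -> 0 < nu ->
  complex.Re l = 0 -> (forall y, rnorm (Sinv y) <= C * rnorm y) ->
  (forall y, nu * rnorm y ^+ 2 <= rinner (Sinv y) y) ->
  exists2 mu : R, 0 < mu & forall x,
    mu * rnorm (diag_perturbation x) ^+ 2 <= rinner (diag_perturbation x) x.
Proof.
move=> C0 nu0 l0 SC Snu; pose K := C + complex.Re `|l|.
have K0 : 0 < K by rewrite ltr_pwDl// -ler0c RRe_real// ger0_real.
exists (nu / K ^+ 2) => [|x]; first by rewrite divr_gt0// exprn_gt0.
rewrite rnorm_hprod_sqr /= rnorm0 expr0n add0r.
have -> : rinner (diag_perturbation x) x = rinner (Sinv x.2) x.2.
  have -> : rinner (diag_perturbation x) x =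
      rinner (0 : H1) x.1 + rinner (Sinv x.2 - l *: x.2) x.2.
    by rewrite /rinner -raddfD.
  rewrite rinnerBl rinnerZxx l0 mul0r subr0.
  by rewrite rinner0l add0r.
apply: le_trans (Snu _); rewrite -mulrA ler_wpM2l ?(ltW nu0)//.
rewrite mulrC ler_pdivrMr ?exprn_gt0// -exprMn.
rewrite ler_sqr ?nnegrE ?mulr_ge0 ?rnorm_ge0 ?(ltW K0)// mulrC mulrDl.
by rewrite (le_trans (rnormB _ _))// rnormZ lerD2r.
Qed.

End DiagonalPerturbation.

(** * Spectra on the imaginary axis *)

Theorem theorem3p6 (R : realType) (H1 H2 : hilbertType R)
    (H1_nonzero : exists x : H1, x != 0) (H2_nonzero : exists x : H2, x != 0)
    (A1 : partial_linear (hprod H1 H2) H1) (A21 : partial_linear H1 H2)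
    (S : {linear H2 -> H2})
    (S_bounded : bounded_operator S) (S_coercive : coercive S)
    (A_ext_gen : generates_contractive_C0_semigroup (A_ext A1 A21)) :
  spectrum (A_S A1 A21 S) `&` imaginary_axis R `<=`
  spectrum (A_ext A1 A21) `&` imaginary_axis R.
Proof.
move=> l [lS limag]; split=> // lext; apply: lS.
have l0 : complex.Re l = 0 by case: limag => w _ <-.
have [Sinv SinvK] := choice (coercive_surjective S_bounded S_coercive).
have [nu nu0 Snu] := coercive_rinner S_coercive.
have Sbelow := coercive_bounded_below nu0 Snu.
have SK : cancel S Sinv.
  move=> x; apply/subr0_eq/rnorm_le0; apply: le_trans (Sbelow _) _.
  by rewrite linearB /= SinvK subrr rnorm0 mulr0.
pose T : {linear H2 -> H2} :=
  HB.pack Sinv (GRing.isLinear.Build _ _ _ _ Sinv (can2_linear SK SinvK)).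
have TS y : rnorm (T y) <= nu^-1 * rnorm y.
  by rewrite -{2}(SinvK y); exact: Sbelow.
have [K K0 SK'] := (bounded_rnormP S).1 S_bounded.
(* With [y = S z], [Re (z | S z) >= nu |z|^2] and [|y| <= K |z|]. *)
have Tcoer y : nu / K ^+ 2 * rnorm y ^+ 2 <= rinner (T y) y.
  rewrite -{1 3}(SinvK y) rinnerC; apply: le_trans (Snu _).
  rewrite -mulrA ler_wpM2l ?(ltW nu0)// mulrC ler_pdivrMr ?exprn_gt0// -exprMn.
  by rewrite ler_sqr ?nnegrE ?mulr_ge0 ?rnorm_ge0 ?(ltW K0)// mulrC.
have nu'0 : 0 < nu^-1 by rewrite invr_gt0.
have nuK0 : 0 < nu / K ^+ 2 by rewrite divr_gt0// exprn_gt0.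
have [mu mu0 Pmu] :=
  @diag_perturbation_cocoercive _ H1 H2 T l _ _ nu'0 nuK0 l0 TS Tcoer.
have [|surj [M M0 bound]] :=
  cocoercive_perturbation (generator_dissipative A_ext_gen) lext _ mu0 Pmu.
  by rewrite l0.
apply: resolvent_set_of_lower_bound.
(* The second component of the perturbed equation says [x2 = S (A21 x1)]. *)
- move=> f; have [[x1 x2] [[dx1 dx21] [/= Ef E2]]] := surj (f, 0).
  have x2E : x2 = S (A21 x1).
    rewrite -(SinvK x2); congr (S _); apply/subr0_eq.
    by rewrite -E2 [RHS]addrC subrKA.
  rewrite x2E in dx1 Ef; exists x1; split; first by split.
  by rewrite -Ef addr0.
(* Conversely, [graph_S A21 S h] solves the perturbed equation with right-hand
   side [(l h - A_S h, 0)]. *)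
- exists M => // h [dh1 dh2].
  have := bound (graph_S A21 S h) (conj dh2 dh1); set g := _ + _ => xg.
  have gE : g = (l *: h - A_S A1 A21 S h, 0) :> hprod H1 H2.
    rewrite /g -[LHS]/(l *: h - A_S A1 A21 S h + 0,
      l *: S (A21 h) - A21 h + (Sinv (S (A21 h)) - l *: S (A21 h))).
    by rewrite SK addr0 addrC subrKA subrr.
  apply: (le_trans (rnorm_hprod_fst (graph_S A21 S h))); apply: le_trans xg _.
  by rewrite gE rnorm_hprod_pair0.
Qed.
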